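(* For every integer $m\ge 0$, $$C_{m}^2=\sum_{k=0}^{m}\frac{(2k+2)\big((2k+1)(2k+3)-(2m+1)\big)}{(2m+1)(2m+2)^2}\binom{2m+2}{m-k}^2.$$
   Context: $C_m=\frac{1}{m+1}\binom{2m}{m}$ is the $m$-th Catalan number. *)

(* Defs.v *)
From mathcomp Require Import all_boot all_order all_algebra.

Set Implicit Arguments.
Unset Strict Implicit.
Unset Printing Implicit Defensive.

Import GRing.Theory.
Local Open Scope ring_scope.

(* Rational-valued, so that no truncated division or subtraction on nat enters
   the formulas it is used in. *)
Definition catalan (m : nat) : rat := (m.+1)%:R^-1 * ('C(2 * m, m))%:R.

(* Main.v *)
(* The sum telescopes: with F(k) = ((2k+1) (m+1-k) binom(2m+2, m+1-k))^2, the
   k-th summand is (F(k) - F(k+1)) / ((2m+1)^2 (2m+2)^2), and F(m+1) = 0 while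
   F(0) = ((m+1) binom(2m+2, m+1))^2 = (2 (2m+1) binom(2m, m))^2. *)
Require Import Defs.
From mathcomp Require Import all_boot all_order all_algebra.
From mathcomp Require Import zify ring.

Set Implicit Arguments.
Unset Strict Implicit.
Unset Printing Implicit Defensive.

Import GRing.Theory.
Local Open Scope ring_scope.

(** Two absorption steps lead down through ['C(2 * m + 1, m)]; this evaluates the telescope at
    [k = 0]. *)
Lemma mul_central_binS (m : nat) :
  (m.+1 * 'C(2 * m + 2, m.+1) = 2 * (2 * m + 1) * 'C(2 * m, m))%N.
Proof.
have diag := mul_bin_diag (2 * m + 2) m.
have down := mul_bin_down (2 * m + 1) m.
rewrite (_ : (2 * m + 2).-1 = 2 * m + 1)%N in diag; last lia.
rewrite (_ : (2 * m + 1).-1 = 2 * m)%N in down; last lia.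
rewrite (_ : (2 * m + 1 - m = m.+1)%N) in down; last lia.
by rewrite -diag -mulnA down; ring.
Qed.

Definition square_telescope (m k : nat) : rat :=
  ((2 * k%:R + 1) * ((m.+1 - k) * 'C(2 * m + 2, m.+1 - k))%:R) ^+ 2.

(** Absorption leaves ['C(2 * m + 2, m - k)] squared times a^2 - b^2, where a = (2k+1)(m+k+2) and b
    = (2k+3)(m-k). Here a + b = (2m+1)(2k+2) and a - b = (2k+1)(2k+3) - (2m+1). *)
Lemma square_telescopeB (m k : nat) : (k <= m)%N ->
  square_telescope m k - square_telescope m k.+1 =
  (2 * m%:R + 1) *
    ((2 * k%:R + 2) * ((2 * k%:R + 1) * (2 * k%:R + 3) - (2 * m%:R + 1)))
  * ('C(2 * m + 2, m - k))%:R ^+ 2.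
Proof.
move=> le_km; rewrite /square_telescope subSS subSn // mul_bin_left.
have -> : (2 * m + 2 - (m - k) = m + k + 2)%N by lia.
rewrite !natrM natrB // !natrD -[in k.+1%:R]addn1 natrD.
by ring.
Qed.

Theorem corollary3p7 (m : nat) :
  catalan m ^+ 2 =
  \sum_(0 <= k < m.+1)
    ((2 * k%:R + 2) * ((2 * k%:R + 1) * (2 * k%:R + 3) - (2 * m%:R + 1)))
      / ((2 * m%:R + 1) * (2 * m%:R + 2) ^+ 2)
    * ('C(2 * m + 2, m - k))%:R ^+ 2 :> rat.
Proof.
have odd_neq0 : 2 * m%:R + 1 != 0 :> rat.
  by rewrite -natrM natr1 Num.Theory.pnatr_eq0.
have succ_neq0 : m%:R + 1 != 0 :> rat by rewrite natr1 Num.Theory.pnatr_eq0.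
have even_neq0 : 2 * m%:R + 2 != 0 :> rat.
  by rewrite -natrM -natrD Num.Theory.pnatr_eq0 addn2.
pose D : rat := (2 * m%:R + 1) ^+ 2 * (2 * m%:R + 2) ^+ 2.
(* The minus sign fits the orientation of [telescope_sumr]; one factor 2m+1 of [D] cancels against
   [square_telescopeB]. *)
transitivity (\sum_(0 <= k < m.+1)
    - (square_telescope m k.+1 - square_telescope m k) / D); last first.
  apply: eq_big_nat => k /andP[_ lt_km].
  rewrite opprB square_telescopeB // /D.
  by field; rewrite odd_neq0 even_neq0.
rewrite -mulr_suml sumrN telescope_sumr // /square_telescope subnn mul0n mulr0.
(* Only the value at [k = 0] over [D] remains: the square of 2 ['C(2 * m, m)] / (2m+2). *)
rewrite subn0 mul_central_binS /catalan /D !natrM natrD natrM -[m.+1%:R]natr1.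
by field; rewrite odd_neq0 succ_neq0 even_neq0.
Qed.
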